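(* Let $X$ be a completely regular space. If $X$ is Čech-complete and Menger, then $X$ is $\sigma$-compact.
   Context: All spaces are assumed completely regular (Tychonoff). A space $X$ is Menger if, given any sequence $\{\mathcal{U}_n\}_{n<\omega}$ of open covers of $X$, there exist finite subsets $\mathcal{V}_n\subseteq\mathcal{U}_n$ such that $\bigcup_{n<\omega}\mathcal{V}_n$ covers $X$. A space is Čech-complete if it is a $G_\delta$ subset of its Stone-Čech compactification $\beta X$. A space is $\sigma$-compact if it is a countable union of compact subspaces. *)

(* Defs.v *)
From HB Require Import structures.
From mathcomp Require Import all_boot all_order all_algebra.
From mathcomp Require Import all_classical all_reals all_analysis.
From mathcomp Require Import borel_hierarchy.

Set Implicit Arguments.
Unset Strict Implicit.
Unset Printing Implicit Defensive.

Import Order.TTheory GRing.Theory Num.Theory.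
Import numFieldNormedType.Exports.

Local Open Scope classical_set_scope.
Local Open Scope ring_scope.

(* [completely_regular_space] does not include any separation of points. *)
Definition tychonoff_space (X : topologicalType) : Prop :=
  completely_regular_space X /\ hausdorff_space X.

Definition open_cover (X : topologicalType) (U : set (set X)) : Prop :=
  (forall A, U A -> open A) /\ \bigcup_(A in U) A = [set: X].

Definition Menger (X : topologicalType) : Prop :=
  forall U : nat -> set (set X), (forall n, open_cover (U n)) ->
  exists V : nat -> set (set X),
    (forall n, finite_set (V n) /\ V n `<=` U n) /\
    \bigcup_n \bigcup_(A in V n) A = [set: X].

(* The members of the sequence may be empty or repeated, so finite unions
   (and the empty space) are included. *)
Definition sigma_compact (X : topologicalType) : Prop :=
  exists2 K : nat -> set X, (forall n, compact (K n)) &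
    \bigcup_n K n = [set: X].

Section StoneCech.
Variables (R : realType) (X : topologicalType).

Definition unit_interval : topologicalType := `[0 : R, 1]%classic.

Definition tychonoff_cube : topologicalType :=
  {ptws continuousType X unit_interval -> unit_interval}.

Definition cube_eval : X -> tychonoff_cube :=
  join_product (fun f : continuousType X unit_interval => f).

(* The Stone-Cech compactification: the closure of the image of X in the cube
   [0, 1]^C(X, [0, 1]), with the subspace topology. *)
Definition stone_cech : topologicalType :=
  set_type (closure (range cube_eval)).

Definition stone_cech_embed (x : X) : stone_cech :=
  exist _ (cube_eval x) (mem_set (subset_closure (imageT cube_eval x))).

(* X is identified with its image in its Stone-Cech compactification; see
   [stone_cech_embed_inj] and [stone_cech_embed_initial]. *)
Definition Cech_complete : Prop := Gdelta (range stone_cech_embed).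

End StoneCech.

Lemma set_type_hausdorff (T : topologicalType) (A : set T) :
  hausdorff_space T -> hausdorff_space (set_type A).
Proof.
move=> hT x y xy; apply/val_inj/hT => U V Ux Vy.
have cv : continuous (set_val : A -> T) := @initial_continuous A T set_val.
have [z [Uz Vz]] := xy _ _ (cv x U Ux) (cv y V Vy).
by exists (set_val z).
Qed.

Lemma set_type_compact (T : topologicalType) (A : set T) :
  compact A -> compact [set: set_type A].
Proof.
move=> cA F FF _.
pose G : set_system T := (set_val : A -> T) @ F.
have GA : G A by apply: (@filterS _ F _ setT) filterT => z _; exact: set_valP.
have [x [Ax clx]] := cA G _ GA.
exists (exist _ x (mem_set Ax)); split => // U V FU [W [[B oB <-] Bx BW]].
have nB : nbhs x B by apply: open_nbhs_nbhs; split.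
have GU : G (set_val @` U) by apply: (@filterS _ F _ U) FU => z Uz; exists z.
have [_ [[z Uz <-] Bz]] := clx _ _ GU nB.
by exists z; split=> //; exact: BW.
Qed.

Section StoneCechTheory.
Variables (R : realType) (X : topologicalType).
Local Notation I := (unit_interval R).
Local Notation bX := (stone_cech R X).
Local Notation e := (@stone_cech_embed R X).

Lemma unit_interval_hausdorff : hausdorff_space I.
Proof. by apply: set_type_hausdorff; exact: norm_hausdorff. Qed.

Lemma unit_interval_compact : compact [set: I].
Proof. by apply: set_type_compact; apply: segment_compact. Qed.

Lemma stone_cech_hausdorff : hausdorff_space bX.
Proof.
apply: set_type_hausdorff.
by apply: (@hausdorff_product (continuousType X I) (fun=> I)) => _; exact: unit_interval_hausdorff.
Qed.

Lemma stone_cech_compact : compact [set: bX].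
Proof.
apply: set_type_compact.
have cT : compact [set: tychonoff_cube R X].
  rewrite (_ : [set: _] = [set f | forall i, [set: I] (f i)]).
    apply: (@tychonoff (continuousType X I) (fun=> I) (fun=> setT)) => _.
    exact: unit_interval_compact.
  by apply/seteqP; split.
by apply: (subclosed_compact _ cT) => //; exact: closed_closure.
Qed.

Lemma stone_cech_embed_dense : dense (range e).
Proof.
move=> V [x Vx] [W oW WV].
have Wx : nbhs (set_val x) W.
  by apply: open_nbhs_nbhs; split=> //; move: Vx; rewrite -WV.
have [_ [[y _ <-] Wy]] := set_valP x _ Wx.
by exists (e y); split; [rewrite -WV | exists y].
Qed.

Lemma stone_cech_extend (f : continuousType X I) :
  exists2 g : bX -> I, continuous g & forall x, g (e x) = f x.
Proof.
exists (fun z => set_val z f) => // z.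
apply: (@continuous_comp _ _ _ (set_val : bX -> tychonoff_cube R X)
  (proj f)).
  exact: initial_continuous.
exact: proj_continuous.
Qed.

Hypothesis tX : tychonoff_space X.

Lemma unit_interval_separates :
  separate_points_from_closed (fun f : continuousType X I => f).
Proof.
move=> U x cU Ux; have := tX.1 x U cU Ux.
move/(@uniform_separatorP X R) => [f [cf fI fx fU]].
have fP y : f y \in `[0 : R, 1]%classic by apply/mem_set/fI; exists y.
pose g y : I := exist _ (f y) (fP y).
have cg : continuous g by apply: continuous_comp_initial.
exists (mkcts cg : continuousType X I) => /= clU.
pose W : set I := set_val @^-1` [set r : R | r < 1].
have nW : nbhs (g x) W.
  apply: open_nbhs_nbhs; split; first by exists [set r : R | r < 1].
  by rewrite /W /= set_valE /= (fx (f x)) ?ltr01 //; exists x.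
have [_ [[y Uy <-]]] := clU _ nW.
by rewrite /W /= set_valE /= (fU (f y)) ?ltxx //; exists y.
Qed.

Lemma cube_eval_inj : set_inj [set: X] (@cube_eval R X).
Proof.
apply: join_product_inj; first exact: unit_interval_separates.
exact/hausdorff_accessible/tX.2.
Qed.

Lemma stone_cech_embed_inj : injective e.
Proof.
by move=> x y /(congr1 set_val) xy; apply: cube_eval_inj; rewrite ?inE.
Qed.

Lemma stone_cech_embed_initial : @open X = @open (initial_topology e).
Proof.
rewrite (@join_product_initial _ _ _ _ unit_interval_separates).
- apply/seteqP; split=> A [B oB BA].
    by exists (set_val @^-1` B) => //; exists B.
  by move: oB => [C oC CB]; exists C => //; rewrite -BA -CB.
- by move=> f; exact: cts_fun.
- exact: cube_eval_inj.
Qed.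

End StoneCechTheory.

(* Main.v *)
Require Import Defs.
From mathcomp Require Import all_boot all_order all_algebra.
From mathcomp Require Import all_classical all_reals all_analysis.
From mathcomp Require Import borel_hierarchy.

Set Implicit Arguments.
Unset Strict Implicit.
Unset Printing Implicit Defensive.

Local Open Scope classical_set_scope.

(* Hurewicz's theorem gives that in a Menger space the first player, who plays
   open covers while the second answers with finite subfamilies, has no winning
   strategy. Write X as the intersection of open sets G_n of bX = stone_cech X,
   and let A_n be an increasing open cover of X whose members have closure in
   bX inside G_n. If P `<=` X is not contained in a sigma-compact set, some n is
   such that no P `\` A_n(m) is either: otherwise P would be contained in one
   compact set \bigcap_n cl (A_n(f n)) and countably many sigma-compact sets.
   Suppose that X is not sigma-compact. The first player keeps a closed P of
   this kind, plays A_n, and after the answer m replaces P by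
   (P `\` A_n(m)) `&` cl (A_i(k)) at round i, for a suitable k. The closures in
   bX of these sets have a common point, which lies in every G_i, hence in X,
   and is never covered, so this strategy wins. *)

(** * The Menger game *)

Section Menger.
Variable X : topologicalType.
Hypothesis mX : Menger X.

(** By directedness one member of [U n] absorbs the whole finite [V n]; nonemptiness serves when
    [V n] is empty. *)
Lemma Menger_directed (U : nat -> set (set X)) :
  (forall n, open_cover (U n)) -> (forall n, U n !=set0) ->
  (forall n A B, U n A -> U n B -> exists2 C, U n C & A `|` B `<=` C) ->
  exists2 A : nat -> set X, (forall n, U n (A n)) & \bigcup_n A n = setT.
Proof.
move=> cU U0 dU; have [V [finV covV]] := mX cU.
have bound n : exists A, U n A /\ \bigcup_(B in V n) B `<=` A.
  have [/finite_seqP[s ->]] := finV n.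
  elim: s => [|B s IHs] sU.
    by have [A UA] := U0 n; exists A; split=> // x [].
  have [|A [UA sA]] := IHs.
    by move=> C sC; apply: sU; rewrite /= inE sC orbT.
  have UB : U n B by apply: sU; rewrite /= inE eqxx.
  have [C UC ABC] := dU n _ _ UA UB; exists C; split=> // x [D /=].
  rewrite inE => /orP[/eqP->|sD] Dx; apply: ABC; first by right.
  by left; apply: sA; exists D.
have [A AP] := choice bound; exists A => [n|]; first by have [] := AP n.
apply/seteqP; split=> // x _; have : setT x by [].
by rewrite -covV => -[n _ Vx]; exists n => //; apply: (AP n).2.
Qed.

Section Game.
(** [T] is the type of positions, [O t] the cover played at [t]. As it is increasing, a finite
    answer amounts to one index [k], which leads to [next t k]. *)
Variables (T : Type) (O : T -> nat -> set X) (next : T -> nat -> T).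
Hypothesis openO : forall t k, open (O t k).
Hypothesis coverO : forall t, \bigcup_k O t k = setT.
Hypothesis monoO : forall t, {homo O t : j k / (j <= k)%N >-> j `<=` k}.

(* The points covered in every play from [t] of the form [s_1, ..., s_i, k]
   with [i <= n]. The moves [j >= k] impose no condition, since
   [O t k `<=` O t j], so the intersection is finite. *)
Fixpoint sure_cover n t k : set X :=
  O t k `&` if n is m.+1
            then \bigcap_(j < k) (O t j `|` sure_cover m (next t j) k)
            else setT.

Lemma sure_cover_open n t k : open (sure_cover n t k).
Proof.
elim: n t k => [|n IHn] t k /=; apply: openI => //; first exact: openT.
rewrite bigcap_mkord; elim/big_ind: _ => //; first exact: openT.
  exact: openI.
by move=> j _; apply: openU.
Qed.

Lemma sure_cover_mono n t j k :
  (j <= k)%N -> sure_cover n t j `<=` sure_cover n t k.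
Proof.
elim: n t j k => [|n IHn] t j k jk x /= [Ox Sx].
  by split=> //; apply: monoO Ox.
split=> [|i ik]; first exact: monoO Ox.
have [ij|ji] := ltnP i j; last by left; apply: monoO Ox.
by have [Oxi|Si] := Sx i ij; [left | right; apply: IHn Si].
Qed.

Lemma sure_cover_cover n t : \bigcup_k sure_cover n t k = setT.
Proof.
apply/seteqP; split=> // x _; elim: n t => [|n IHn] t.
  by have : setT x by []; rewrite -(coverO t) => -[k _ Ok]; exists k.
have : setT x by [].
rewrite -(coverO t) => -[k _ Ok].
have /choice[g gP] : forall j, exists i, sure_cover n (next t j) i x.
  by move=> j; have [i _ Si] := IHn (next t j); exists i.
have gm j : (j < k)%N -> (g j <= maxn k (\max_(i < k) g i))%N.
  by move=> jk; rewrite leq_max (leq_bigmax (Ordinal jk)) orbT.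
(* Only the finitely many [j < k] need their own index [g j]; [O t k] settles the others. *)
exists (maxn k (\max_(i < k) g i)) => //; split=> [|j /= _].
  by apply: monoO Ok; rewrite leq_maxl.
have [jk|kj] := ltnP j k; last by left; apply: monoO Ok.
by right; apply: sure_cover_mono (gP j); apply: gm.
Qed.

(** Peels off the first move, as [sure_cover] does; [playS] peels off the last. *)
Fixpoint play t (f : nat -> nat) n :=
  if n is m.+1 then play (next t (f 0%N)) (f \o succn) m else t.

Lemma playS t f n : play t f n.+1 = next (play t f n) (f n).
Proof. by elim: n t f => //= n IHn t f; rewrite -IHn. Qed.

(** If [f 0 < f n], the first move is among those that [sure_cover] ranges over, so it covers [x] or
    induction applies to the tail; otherwise [O t (f n)] lies inside [O t (f 0)]. *)
Lemma sure_cover_play n t f x : sure_cover n t (f n) x ->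
  exists m, O (play t f m) (f m) x.
Proof.
elim: n t f => [|n IHn] t f /= [Ox Sx]; first by exists 0%N.
have [f0n|nf0] := ltnP (f 0%N) (f n.+1); last first.
  by exists 0%N => /=; apply: monoO Ox.
have [Ox0|S0] := Sx _ f0n; first by exists 0%N.
by have [m Om] := IHn _ (f \o succn) S0; exists m.+1.
Qed.

(* Hurewicz: the first player has no winning strategy in the Menger game. *)
Lemma Menger_game t :
  exists f : nat -> nat, \bigcup_n O (play t f n) (f n) = setT.
Proof.
(* These covers depend on [n] but not on earlier moves, so the Menger property applies to the whole
   sequence. *)
have [n|n|n A B [i _ <-] [j _ <-]|A AP covA] :=
  @Menger_directed (fun n => range (sure_cover n t)).
- split=> [A [k _ <-]|]; first exact: sure_cover_open.
  by rewrite bigcup_image sure_cover_cover.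
- by exists (sure_cover n t 0); exists 0%N.
- exists (sure_cover n t (maxn i j)); first by exists (maxn i j).
  by move=> x [] ; apply: sure_cover_mono; rewrite ?leq_maxl ?leq_maxr.
have /choice[f fP] : forall n, exists k, sure_cover n t k = A n.
  by move=> n; have [k _ kA] := AP n; exists k.
exists f; apply/seteqP; split=> // x _; have : setT x by [].
rewrite -covA => -[n _]; rewrite -fP => /sure_cover_play[m Om].
by exists m.
Qed.

End Game.
End Menger.

(** * The sigma-ideal generated by the compact sets *)

Section SigmaIdeal.
Variable X : topologicalType.

Definition sub_sigma_compact (A : set X) : Prop :=
  exists2 K : nat -> set X, (forall n, compact (K n)) & A `<=` \bigcup_n K n.

Lemma sub_sigma_compactS A B :
  A `<=` B -> sub_sigma_compact B -> sub_sigma_compact A.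
Proof. by move=> AB [K cK BK]; exists K => //; apply: subset_trans BK. Qed.

Lemma compact_sub_sigma_compact A : compact A -> sub_sigma_compact A.
Proof. by move=> cA; exists (fun=> A) => // x Ax; exists 0%N. Qed.

Lemma sub_sigma_compact_bigcup (A : nat -> set X) :
  (forall n, sub_sigma_compact (A n)) -> sub_sigma_compact (\bigcup_n A n).
Proof.
move=> sA.
have /choice[K KP] : forall n, exists K : nat -> set X,
    (forall m, compact (K m)) /\ A n `<=` \bigcup_m K m.
  by move=> n; have [K] := sA n; exists K.
(* Numbers that code no pair get the empty set, which is compact. *)
exists (fun p => if unpickle p is Some (n, m) then K n m else set0) => [p|].
  by case: unpickle => [[n m]|]; [apply: (KP n).1 | exact: compact0].
move=> x [n _ /(KP n).2[m _ Kx]].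
by exists (pickle (n, m)) => //; rewrite pickleK.
Qed.

Lemma sub_sigma_compactU A B :
  sub_sigma_compact A -> sub_sigma_compact B -> sub_sigma_compact (A `|` B).
Proof.
move=> sA sB; rewrite -bigcup2E; apply: sub_sigma_compact_bigcup => -[|[|n]] //.
by apply: compact_sub_sigma_compact; exact: compact0.
Qed.

End SigmaIdeal.

(** * G-delta images in a compact Hausdorff space *)

Section GdeltaInCompact.
Variables (X Y : topologicalType) (e : X -> Y).
Hypothesis initial_e : @open X = @open (initial_topology e).
Hypothesis hY : hausdorff_space Y.
Hypothesis cY : compact [set: Y].

Lemma initial_openP (A : set X) :
  open A <-> exists2 B, open B & e @^-1` B = A.
Proof. by rewrite initial_e. Qed.

Lemma initial_map_continuous : continuous e.
Proof. by apply/continuousP => A oA; apply/initial_openP; exists A. Qed.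

Lemma initial_nbhs (x : X) (U : set X) :
  nbhs x U -> exists2 W, nbhs (e x) W & e @^-1` W `<=` U.
Proof.
rewrite nbhsE => -[V [/initial_openP[B oB <-] Bx] BU]; exists B => //.
exact: open_nbhs_nbhs.
Qed.

Lemma compact_preimage_initial (K : set Y) :
  compact K -> K `<=` range e -> compact (e @^-1` K).
Proof.
move=> cK Ke F FF FK; have [z [Kz clz]] := cK (e @ F) _ FK.
have [x _ xz] := Ke _ Kz; exists x; split; first by rewrite /= xz.
move=> U V FU /initial_nbhs[W nW WV].
have eFU : (e @ F) (e @` U) by apply: (@filterS _ F _ U) FU => y Uy; exists y.
rewrite xz in nW.
have [_ [[y Uy <-] Wy]] := clz _ _ eFU nW.
by exists y; split=> //; apply: WV.
Qed.

Lemma preimage_closure_image (P : set X) :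
  closed P -> e @^-1` closure (e @` P) = P.
Proof.
move=> cP; apply/seteqP; split=> x /=; last first.
  by move=> Px; apply: subset_closure; exists x.
move=> clx; apply: cP => U /initial_nbhs[W nW WU].
have [_ [[y Py <-] Wy]] := clx _ nW.
by exists y; split=> //; apply: WU.
Qed.

(** Pick a point in each [P n]. A cluster point in [Y] of their images lies in every closure, hence
    in every [G n], hence in [range e]. *)
Lemma nested_closed_meet (G : nat -> set Y) (P : nat -> set X) :
  \bigcap_n G n `<=` range e ->
  (forall n, closed (P n)) -> (forall n, P n !=set0) ->
  (forall n, P n.+1 `<=` P n) ->
  (forall n, closure (e @` P n.+1) `<=` G n) ->
  \bigcap_n P n !=set0.
Proof.
move=> Ge clP P0 decP PG; have [u uP] := choice P0.
have decPle m n : (m <= n)%N -> P n `<=` P m.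
  elim: n => [|n IHn]; first by rewrite leqn0 => /eqP->.
  rewrite leq_eqVlt => /predU1P[->//|]; rewrite ltnS => /IHn mn.
  exact: subset_trans (decP n) mn.
have [z [_ clz]] := cY (F := (e \o u) @ \oo) _ filterT.
have zP n : closure (e @` P n) z.
  move=> W nW; apply: clz nW; exists n => // m /= nm.
  by exists (u m) => //; apply: decPle nm _ _.
have [x _ xz] : range e z by apply: Ge => n _; apply: PG.
by exists x => n _; rewrite -(preimage_closure_image (clP n)) /= xz.
Qed.

Hypothesis mX : Menger X.

(** Regularity of [Y] shrinks [G] around each point; the Menger property for a constant sequence
    extracts a countable subcover, and finite unions make it increasing. *)
Lemma Menger_shrunk_cover (G : set Y) : open G -> range e `<=` G ->
  exists A : nat -> set X,
    [/\ forall k, open (A k), {homo A : j k / (j <= k)%N >-> j `<=` k},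
        \bigcup_k A k = setT & forall k, closure (e @` A k) `<=` G].
Proof.
move=> oG eG; pose U := [set A | open A /\ closure (e @` A) `<=` G].
have U0 : U set0 by split; [exact: open0 | rewrite image_set0 closure0].
have UU A B : U A -> U B -> U (A `|` B).
  move=> [oA AG] [oB BG]; split; first exact: openU.
  by rewrite image_setU closureU subUset.
have cU : open_cover U.
  split=> [A []//|]; apply/seteqP; split=> // x _.
  have nG : nbhs (e x) G by apply: open_nbhs_nbhs; split=> //; apply: eG; exists x.
  have [W nW WG] := compact_regular hY cY filterT nG.
  exists (e @^-1` W°) => /=; last exact: nW.
  split; first by apply/initial_openP; exists W° => //; exact: open_interior.
  apply: subset_trans WG; apply: closureS => _ [y Wy <-]; exact: interior_subset.
have [n|n|n A B UA UB|A UA covA] := @Menger_directed _ mX (fun=> U).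
- exact: cU.
- by exists set0.
- by exists (A `|` B) => //; apply: UU.
have UbigA k : U (\big[setU/set0]_(i < k.+1) A i) by elim/big_ind: _.
exists (fun k => \big[setU/set0]_(i < k.+1) A i); split.
- by move=> k; have [] := UbigA k.
- by move=> j k jk; apply: subset_bigsetU; rewrite ltnS.
- apply/seteqP; split=> // x _; have : setT x by [].
  rewrite -covA => -[n _ Ax]; exists n => //.
  by rewrite -bigcup_mkord; exists n => /=.
- by move=> k; have [] := UbigA k.
Qed.

Lemma Menger_Gdelta_sub_sigma_compact :
  Gdelta (range e) -> sub_sigma_compact [set: X].
Proof.
move=> [G oG eG].
have /choice[A AP] : forall n, exists A : nat -> set X,
    [/\ forall k, open (A k), {homo A : j k / (j <= k)%N >-> j `<=` k},
        \bigcup_k A k = setT & forall k, closure (e @` A k) `<=` G n].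
  move=> n; apply: Menger_shrunk_cover; first exact: oG.
  by rewrite eG; apply: bigcap_inf.
pose E n k := e @^-1` closure (e @` A n k).
have AE n k : A n k `<=` E n k by move=> x Ax; apply: subset_closure; exists x.
have clE n k : closed (E n k).
  apply: preimage_closed; last exact: closed_closure.
  by move=> x _; apply: initial_map_continuous.
(* The intersection of the closures, taken in [Y], stays in every [G n], hence in [range e]. *)
have compactE f : compact (\bigcap_n E n (f n)).
  rewrite (_ : \bigcap_n _ = e @^-1` \bigcap_n closure (e @` A n (f n))) //.
  apply: compact_preimage_initial; last first.
    by rewrite eG => y Ey n _; have [_ _ _] := AP n; apply; apply: Ey.
  apply: (subclosed_compact _ cY) => //; apply: closed_bigI => n _.
  exact: closed_closure.
have split_big P : ~ sub_sigma_compact P ->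
    exists n, forall m, ~ sub_sigma_compact (P `\` A n m).
  move=> bigP; apply: contrapT => /forallNP H; apply: bigP.
  have /choice[f fP] : forall n, exists m, sub_sigma_compact (P `\` A n m).
    by move=> n; have /existsNP[m /contrapT] := H n; exists m.
  apply: (@sub_sigma_compactS _ _
    (\bigcap_n E n (f n) `|` \bigcup_n (P `\` A n (f n)))).
    move=> x Px; have [Ex|/existsNP[n nEx]] := pselect (forall n, E n (f n) x).
      by left=> n _; apply: Ex.
    by right; exists n => //; split=> // /AE /nEx.
  apply: sub_sigma_compactU; last exact: sub_sigma_compact_bigcup.
  exact: compact_sub_sigma_compact.
have step P i : ~ sub_sigma_compact P ->
    exists k, ~ sub_sigma_compact (P `&` E i k).
  move=> bigP; apply/existsNP => H; apply: bigP.
  apply: sub_sigma_compactS (sub_sigma_compact_bigcup H) => x Px.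
  have [_ _ covA _] := AP i; have : setT x by [].
  by rewrite -covA => -[k _ /AE Ex]; exists k.
apply: contrapT => bigX.
(* The round number, stored with the set, tells which [G i] must contain the closure of the next
   set. *)
pose S := {p : nat * set X | closed p.2 /\ ~ sub_sigma_compact p.2}.
have /choice[s sP] : forall t : S, exists s : (nat -> set X) * (nat -> S),
    [/\ forall k, open (s.1 k), {homo s.1 : j k / (j <= k)%N >-> j `<=` k},
        \bigcup_k s.1 k = setT &
        forall k, [/\ (sval (s.2 k)).1 = (sval t).1.+1,
          (sval (s.2 k)).2 `<=` (sval t).2 `\` s.1 k &
          closure (e @` (sval (s.2 k)).2) `<=` G (sval t).1]].
  (* Two indices: [n] depends on [P] and picks the cover to play; [i] is the round and picks the
     family [E i] to cut with. *)
  move=> [[i P] [/= clP bigP]]; have [n nP] := split_big P bigP.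
  have /choice[k kP] m := step _ i (nP m).
  have [oA mA cA _] := AP n.
  have clQ m : closed ((P `\` A n m) `&` E i (k m)).
    by apply: closedI => //; apply: closedI => //; apply: open_closedC.
  exists (A n, fun m => exist _ (i.+1, (P `\` A n m) `&` E i (k m))
                          (conj (clQ m) (kP m))).
  split=> //= m; split=> //.
  have [_ _ _ AG] := AP i; apply: subset_trans (AG (k m)).
  apply: subset_trans (@closed_closure _ _); apply: closureS => _ [x [_ Ex] <-].
  exact: Ex.
pose O t := (s t).1; pose next t := (s t).2.
pose t0 : S := exist _ (0%N, setT) (conj closedT bigX).
have [t k|t|t|f fP] := @Menger_game _ mX S O next _ _ _ t0.
- by have [+ _ _ _] := sP t; apply.
- by have [_ _ + _] := sP t.
- by have [_ + _ _] := sP t.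
pose p n := sval (play next t0 f n).
have pS n : [/\ (p n.+1).1 = (p n).1.+1,
    (p n.+1).2 `<=` (p n).2 `\` O (play next t0 f n) (f n) &
    closure (e @` (p n.+1).2) `<=` G (p n).1].
  rewrite /p playS; have [_ _ _ H] := sP (play next t0 f n).
  exact: H.
have p1 n : (p n).1 = n by elim: n => // n IHn; have [-> _ _] := pS n; rewrite IHn.
have [|n|n|n|n|x Px] := @nested_closed_meet G (fun n => (p n).2).
- by rewrite -eG.
- by rewrite /p; case: (play _ _ _ n) => /= ? [].
- rewrite /p; case: (play _ _ _ n) => /= q [_ bigq].
  apply/set0P/eqP => q0; apply: bigq; rewrite q0.
  by apply: compact_sub_sigma_compact; exact: compact0.
- by have [_ H _] := pS n; move=> x /H[].
- by have [_ _] := pS n; rewrite p1.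
(* The play covers [x] at some round [n], but the next set avoids what was covered then. *)
have : setT x by []; rewrite -fP => -[n _ Ox].
by have [_ H _] := pS n; have [] := H x (Px n.+1 I).
Qed.

End GdeltaInCompact.

Theorem theorem1p2 (R : realType) (X : topologicalType)
    (tychonoffX : tychonoff_space X)
    (Cech_completeX : Cech_complete R X) (MengerX : Menger X) :
  sigma_compact X.
Proof.
have [K cK XK] := Menger_Gdelta_sub_sigma_compact
  (stone_cech_embed_initial R tychonoffX) (@stone_cech_hausdorff R X)
  (@stone_cech_compact R X) MengerX Cech_completeX.
by exists K => //; apply/seteqP; split.
Qed.
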